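(* Let $u^-\in\mathcal{L}^2([t_0,t_f];\mathbb{R}^m)$. The projection $P_{\mathcal{B}}(u^-)$ of $u^-$ onto the constraint set $\mathcal{B}$, i.e. the solution of the problem of minimizing $\frac12\|u-u^-\|_{\mathcal{L}^2}^2$ subject to $u\in\mathcal{B}$, is given by $$[P_{\mathcal{B}}(u^-)(t)]_i=\begin{cases}a_i,&\text{if }u^-_i(t)\ge a_i,\\ u^-_i(t),&\text{if }-a_i\le u^-_i(t)\le a_i,\\ -a_i,&\text{if }u^-_i(t)\le -a_i,\end{cases}$$ for all $t\in[t_0,t_f]$, $i=1,\dots,m$.
   Context: $\mathcal{L}^2([t_0,t_f];\mathbb{R}^m)$ is the Hilbert space of square-integrable functions with norm $\|z\|_{\mathcal{L}^2}=(\int_{t_0}^{t_f}\|z(t)\|^2dt)^{1/2}$, where $\|\cdot\|$ is the Euclidean norm (functions identified when equal almost everywhere). For nonnegative reals $a_1,\dots,a_m$, $$\mathcal{B}:=\{u\in\mathcal{L}^2([t_0,t_f];\mathbb{R}^m)\,:\,-a_i\le u_i(t)\le a_i\ \ \forall t\in[t_0,t_f],\ i=1,\dots,m\}.$$ *)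

(* Defs.v *)
From HB Require Import structures.
From mathcomp Require Import all_boot all_order all_algebra.
From mathcomp Require Import all_classical all_reals all_analysis measurable_realfun.
From mathcomp Require Import ring lra.

Set Implicit Arguments.
Unset Strict Implicit.
Unset Printing Implicit Defensive.

Import Order.TTheory GRing.Theory Num.Theory.
Import numFieldNormedType.Exports.
Local Open Scope classical_set_scope.
Local Open Scope quotient_scope.
Local Open Scope ring_scope.

(* The Euclidean norm; the library norm `|v| on 'rV[R]_m is the sup norm. *)
Definition enorm (R : realType) (m : nat) (v : 'rV[R]_m) : R :=
  Num.sqrt (\sum_(i < m) v 0 i ^+ 2).

Lemma enorm_sqr (R : realType) (m : nat) (v : 'rV[R]_m) :
  enorm v ^+ 2 = \sum_(i < m) v 0 i ^+ 2.
Proof. by rewrite sqr_sqrtr// sumr_ge0// => i _; exact: sqr_ge0. Qed.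

Section L2.
Variables (R : realType) (t0 tf : R) (m : nat).

Local Notation mu := (@lebesgue_measure R).
Local Notation D := `[t0, tf]%classic.

(* Functions on [t0, tf] are represented by total functions on R; their values
   outside [t0, tf] play no role after passing to the quotient below. *)
Definition square_integrable (f : R -> 'rV[R]_m) : Prop :=
  (forall i : 'I_m, measurable_fun D (fun t => f t 0 i)) /\
  (\int[mu]_(t in D) (enorm (f t) ^+ 2)%:E < +oo)%E.

Definition sqint : {pred R -> 'rV[R]_m} := mem [set f | square_integrable f].

Lemma sqintP (f : R -> 'rV[R]_m) : reflect (square_integrable f) (f \in sqint).
Proof. by apply: (iffP idP); rewrite /sqint inE. Qed.

Lemma measurable_enorm_sqr (f : R -> 'rV[R]_m) :
  (forall i : 'I_m, measurable_fun D (fun t => f t 0 i)) ->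
  measurable_fun D (EFin \o (fun t => enorm (f t) ^+ 2)).
Proof.
move=> mf; apply/measurable_EFinP.
rewrite (_ : (fun t => _) = fun t => \sum_(i < m) f t 0 i ^+ 2); last first.
  by apply/funext => t; rewrite enorm_sqr.
apply: measurable_sum => i; exact: measurable_funX.
Qed.

Lemma sqint_zmod_closed : zmod_closed sqint.
Proof.
split.
  apply/sqintP; split=> [i|].
    rewrite (_ : (fun t => _) = cst 0); first exact: measurable_cst.
    by apply/funext => t; rewrite /= mxE.
  rewrite integral0_eq// => t _; rewrite enorm_sqr big1// => i _.
  by rewrite mxE expr0n.
move=> f g /sqintP[mf If] /sqintP[mg Ig]; apply/sqintP.
have mfg (i : 'I_m) : measurable_fun D (fun t => (f - g) t 0 i).
  rewrite (_ : (fun t => _) = (fun t => f t 0 i) \- (fun t => g t 0 i)).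
    exact: measurable_funB.
  by apply/funext => t; rewrite /= !mxE.
split=> //.
have ge0 (h : R -> 'rV[R]_m) t : (0 <= (enorm (h t) ^+ 2)%:E)%E.
  by rewrite lee_fin sqr_ge0.
have mD : measurable D by [].
apply: (@le_lt_trans _ _ (\int[mu]_(t in D)
    (2%:E * ((enorm (f t) ^+ 2)%:E + (enorm (g t) ^+ 2)%:E)))%E).
  have sge0 t : (0 <= 2%:E * ((enorm (f t) ^+ 2)%:E + (enorm (g t) ^+ 2)%:E))%E.
    by rewrite mule_ge0// adde_ge0.
  have ms : measurable_fun D (fun t =>
      2%:E * ((enorm (f t) ^+ 2)%:E + (enorm (g t) ^+ 2)%:E))%E.
    apply: measurable_funeM; apply: emeasurable_funD;
      exact: measurable_enorm_sqr.
  have md := measurable_enorm_sqr mfg.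
  apply: ge0_le_integral => //.
  move=> t _; rewrite -EFinD -EFinM lee_fin !enorm_sqr -big_split/=.
  rewrite big_distrr/=; apply: ler_sum => i _; rewrite !mxE.
  by have := sqr_ge0 (f t 0 i + g t 0 i); nra.
rewrite ge0_integralZl//.
- rewrite ge0_integralD//; [|exact: measurable_enorm_sqr..].
  by rewrite lte_mul_pinfty// lte_add_pinfty.
- apply: emeasurable_funD; exact: measurable_enorm_sqr.
- by move=> t _; rewrite adde_ge0.
Qed.

HB.instance Definition _ :=
  GRing.isZmodClosed.Build (R -> 'rV[R]_m) sqint sqint_zmod_closed.

Record L2fun := MkL2fun {
  L2fun_val :> R -> 'rV[R]_m;
  _ : L2fun_val \in sqint }.

HB.instance Definition _ := [isSub for L2fun_val].
HB.instance Definition _ := [Choice of L2fun by <:].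
HB.instance Definition _ := [SubChoice_isSubZmodule of L2fun by <:].

Definition ae_zero : {pred L2fun} :=
  mem [set f : L2fun | ae_eq mu D f (cst 0)].

Lemma ae_zeroP (f : L2fun) :
  reflect (ae_eq mu D f (cst 0)) (f \in ae_zero).
Proof. by apply: (iffP idP); rewrite /ae_zero inE. Qed.

Lemma ae_zero_zmod_closed : zmod_closed ae_zero.
Proof.
split; first by apply/ae_zeroP; exact: aeW.
move=> f g /ae_zeroP f0 /ae_zeroP g0; apply/ae_zeroP.
have F := ae_filter_ringOfSetsType mu.
apply: filterS2 f0 g0 => t f0 g0 Dt.
transitivity (f t - g t) => //.
by rewrite f0// g0// subr0.
Qed.

HB.instance Definition _ :=
  GRing.isZmodClosed.Build L2fun ae_zero ae_zero_zmod_closed.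

(* L^2([t0, tf]; R^m): square-integrable functions modulo equality almost
   everywhere on [t0, tf]. *)
Definition L2 : Type := Quotient.quot ae_zero.

HB.instance Definition _ := GRing.Zmodule.on L2.
HB.instance Definition _ := EqQuotient.on L2.

Definition L2class (f : L2fun) : L2 := \pi_(L2) f.

Definition L2norm (z : L2) : R :=
  Num.sqrt (\int[mu]_(t in D) (enorm (repr z t) ^+ 2)).

Lemma L2class_eqP (f g : L2fun) :
  L2class f = L2class g <-> ae_eq mu D f g.
Proof.
have F := ae_filter_ringOfSetsType mu.
split=> [/eqP|fg].
  rewrite eqmodE => /ae_zeroP; apply: filterS => t fg Dt.
  by apply/eqP; rewrite -subr_eq0; apply/eqP; exact: fg.
apply/eqP; rewrite eqmodE; apply/ae_zeroP; apply: filterS fg => t fg Dt.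
by transitivity (f t - g t) => //; rewrite fg// subrr.
Qed.

Lemma L2class_sub (f g : L2fun) : L2class (f - g) = L2class f - L2class g.
Proof. by rewrite /L2class raddfB. Qed.

Lemma L2norm_class (f : L2fun) :
  L2norm (L2class f) = Num.sqrt (\int[mu]_(t in D) (enorm (f t) ^+ 2)).
Proof.
have F := ae_filter_ringOfSetsType mu.
have /L2class_eqP fr : L2class (repr (L2class f)) = L2class f.
  exact: reprK.
have mh (h : L2fun) : measurable_fun D (EFin \o (fun t => enorm (h t) ^+ 2)).
  by apply: measurable_enorm_sqr => i; have /sqintP[] := valP h.
congr Num.sqrt; rewrite /Rintegral; congr fine.
apply: ae_eq_integral => //; [exact: mh|exact: mh|].
by apply: filterS fr => t fr Dt; rewrite fr.
Qed.

(* A class belongs to the box when one of its representatives satisfies the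
   bounds at every point of [t0, tf]. *)
Definition box (a : 'I_m -> R) : set L2 :=
  [set z | exists2 u : L2fun, L2class u = z &
     forall t, t0 <= t <= tf -> forall i, - a i <= u t 0 i <= a i].

Definition is_projection (K : set L2) (z w : L2) : Prop :=
  K w /\ forall u, K u ->
    2^-1 * L2norm (w - z) ^+ 2 <= 2^-1 * L2norm (u - z) ^+ 2.

End L2.

(* Main.v *)
Require Import Defs.
From mathcomp Require Import all_boot all_order all_algebra.
From mathcomp Require Import all_classical all_reals all_analysis.
From mathcomp Require Import measurable_realfun lra.
Import Order.TTheory GRing.Theory Num.Theory.
Local Open Scope ring_scope.

(** The projection onto a box is computed pointwise and coordinatewise.  For a
    real [x] and [0 <= b], let [c] be the point of [[-b, b]] closest to [x].
    Every [y] in [[-b, b]] satisfies [0 <= (y - c) (c - x)], hence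
      [(c - x)^2 + (y - c)^2 <= (y - x)^2]                  ([clamp_pythagoras]).
    Let [v] represent the class to be projected, and let [p] be obtained from [v]
    by truncating each coordinate in this way.  It is measurable and [||p(t)|| <= ||v(t)||], so it is square
    integrable, and it lies in the box.  Summing the inequality over the
    coordinates and integrating over the interval gives, for all [u] in the box,
      [||p - v||^2 + ||u - p||^2 <= ||u - v||^2]            ([box_pythagoras]).
    Dropping the second term shows that [p] is a minimizer; and if [u] is a
    minimizer too, the same inequality forces [||u - p|| = 0], so that [u] and
    [p] are the same class by definiteness of the norm ([L2norm_eq0]). *)

(** The point of [[-b, b]] closest to [x], when [0 <= b]. *)
Definition clamp {R : realType} (b x : R) : R := Num.max (- b) (Num.min b x).

Lemma clamp_bounds {R : realType} (b x : R) :
  0 <= b -> - b <= clamp b x <= b.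
Proof.
by move=> b0; rewrite /clamp le_max lexx/= ge_max ge_min lexx/= andbT; lra.
Qed.

Lemma clamp_ge {R : realType} (b x : R) : 0 <= b -> b <= x -> clamp b x = b.
Proof. by move=> b0 bx; rewrite /clamp (min_l bx) max_r//; lra. Qed.

Lemma clamp_id {R : realType} (b x : R) : - b <= x <= b -> clamp b x = x.
Proof. by move=> /andP[bx xb]; rewrite /clamp (min_r xb) max_r. Qed.

Lemma clamp_le {R : realType} (b x : R) : 0 <= b -> x <= - b -> clamp b x = - b.
Proof. by move=> b0 xb; rewrite /clamp min_r ?max_l//; lra. Qed.

(** The three cases of the truncation, for use by case analysis ([clampP]); they
    overlap at the end points, where the values agree. *)
Variant clamp_spec {R : realType} (b x : R) : R -> Type :=
  | ClampGe of b <= x : clamp_spec b x b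
  | ClampId of - b <= x <= b : clamp_spec b x x
  | ClampLe of x <= - b : clamp_spec b x (- b).

Lemma clampP {R : realType} (b x : R) : 0 <= b -> clamp_spec b x (clamp b x).
Proof.
move=> b0; have [bx|/ltW xb] := leP b x.
  by rewrite clamp_ge//; constructor.
have [bx|/ltW bx] := leP (- b) x; last by rewrite clamp_le//; constructor.
by rewrite clamp_id ?bx//; constructor; rewrite bx.
Qed.

Lemma clamp_sqr_le {R : realType} (b x : R) : 0 <= b -> clamp b x ^+ 2 <= x ^+ 2.
Proof. by move=> b0; case: clampP => // ?; nra. Qed.

(** The obtuse angle inequality at the closest point. *)
Lemma clamp_pythagoras {R : realType} (b x y : R) :
  0 <= b -> - b <= y <= b ->
  (clamp b x - x) ^+ 2 + (y - clamp b x) ^+ 2 <= (y - x) ^+ 2.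
Proof. by move=> b0 /andP[by1 by2]; case: clampP => // ?; nra. Qed.

Lemma L2fun_measurable {R : realType} {t0 tf : R} {m : nat}
    (f : L2fun t0 tf m) (i : 'I_m) :
  measurable_fun `[t0, tf]%classic (fun t => f t 0 i).
Proof. by have /sqintP[] := valP f. Qed.

Lemma L2fun_integrable {R : realType} {t0 tf : R} {m : nat}
    (f : L2fun t0 tf m) :
  (@lebesgue_measure R).-integrable `[t0, tf]%classic
    (EFin \o (fun t => enorm (f t) ^+ 2)).
Proof.
have /sqintP[mf If] := valP f; apply/integrableP; split.
  exact: measurable_enorm_sqr.
under eq_integral => t _ do rewrite /= ger0_norm ?sqr_ge0//.
exact: If.
Qed.

Lemma L2norm_class_sqr {R : realType} {t0 tf : R} {m : nat}
    (f : L2fun t0 tf m) :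
  L2norm (L2class f) ^+ 2 =
  \int[@lebesgue_measure R]_(t in `[t0, tf]%classic) (enorm (f t) ^+ 2).
Proof.
by rewrite L2norm_class sqr_sqrtr// Rintegral_ge0// => t _; exact: sqr_ge0.
Qed.

Lemma enorm_eq0 {R : realType} {m : nat} (v : 'rV[R]_m) :
  enorm v ^+ 2 = 0 -> v = 0.
Proof.
rewrite enorm_sqr => /psumr_eq0P v0; apply/rowP => i; rewrite mxE.
by apply/eqP; rewrite -(sqrf_eq0 (v 0 i)); apply/eqP/v0 => // j _; exact: sqr_ge0.
Qed.

Lemma L2norm_eq0 {R : realType} {t0 tf : R} {m : nat} (z : L2 t0 tf m) :
  L2norm z ^+ 2 = 0 -> z = 0.
Proof.
rewrite -[z]reprK -/(L2class _); set f := repr z.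
rewrite L2norm_class_sqr => f0.
have F := ae_filter_ringOfSetsType (@lebesgue_measure R).
transitivity (L2class (0 : L2fun t0 tf m)); last by rewrite /L2class raddf0.
apply/L2class_eqP.
have mf := measurable_enorm_sqr (L2fun_measurable f).
have mD : measurable (`[t0, tf]%classic : set (measurableTypeR R)) by [].
have : (\int[@lebesgue_measure R]_(t in `[t0, tf]%classic)
    `|(EFin \o (fun t => enorm (f t) ^+ 2)%R) t| = 0)%E.
  transitivity (\int[@lebesgue_measure R]_(t in `[t0, tf]%classic)
      (enorm (f t) ^+ 2)%R%:E)%E.
    by apply: eq_integral => t _ /=; rewrite ger0_norm ?sqr_ge0.
  have /fineK <- := integrable_fin_num mD (L2fun_integrable f).
  by congr EFin.
move=> /(ae_eq_integral_abs _ mD mf); apply: filterS => t ft Dt.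
by apply: enorm_eq0; have [] := ft Dt.
Qed.

Lemma L2norm_sqrD_le {R : realType} {t0 tf : R} {m : nat}
    (f g h : L2fun t0 tf m) :
  (forall t, t0 <= t <= tf ->
     enorm (f t) ^+ 2 + enorm (g t) ^+ 2 <= enorm (h t) ^+ 2) ->
  L2norm (L2class f) ^+ 2 + L2norm (L2class g) ^+ 2 <= L2norm (L2class h) ^+ 2.
Proof.
move=> fgh; rewrite !L2norm_class_sqr -RintegralD//; try exact: L2fun_integrable.
apply: le_Rintegral => //.
- by apply: (integrableD _ (L2fun_integrable f) (L2fun_integrable g)).
- exact: L2fun_integrable.
Qed.

(** Coordinatewise truncation, on the whole line; only the values on
    [[t0, tf]] matter. *)
Definition clamp_fun {R : realType} {m : nat} (a : 'I_m -> R)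
    (v : R -> 'rV[R]_m) : R -> 'rV[R]_m :=
  fun t => \row_i clamp (a i) (v t 0 i).

Lemma clamp_fun_sqint {R : realType} {t0 tf : R} {m : nat} (a : 'I_m -> R)
    (v : L2fun t0 tf m) :
  (forall i, 0 <= a i) -> clamp_fun a v \in @sqint R t0 tf m.
Proof.
move=> a0; apply/sqintP.
have mp i : measurable_fun `[t0, tf]%classic (fun t => clamp_fun a v t 0 i).
  rewrite (_ : (fun t => _) = cst (- a i) \max (cst (a i) \min (fun t => v t 0 i))).
    apply: measurable_maxr; first exact: measurable_cst.
    by apply: measurable_minr; [exact: measurable_cst|exact: L2fun_measurable].
  by apply/funext => t; rewrite mxE.
split=> //; have /sqintP[mv] := valP v; apply: le_lt_trans.
apply: ge0_le_integral => //.
- by move=> t _; rewrite lee_fin sqr_ge0.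
- exact: measurable_enorm_sqr.
- exact: measurable_enorm_sqr.
- move=> t _; rewrite lee_fin !enorm_sqr; apply: ler_sum => i _.
  by rewrite mxE clamp_sqr_le.
Qed.

(** The obtuse angle inequality at a coordinatewise truncation [p] of [v]. *)
Lemma box_pythagoras {R : realType} {t0 tf : R} {m : nat} (a : 'I_m -> R)
    (v p u : L2fun t0 tf m) :
  (forall i, 0 <= a i) -> p = clamp_fun a v :> (R -> 'rV[R]_m) ->
  (forall t, t0 <= t <= tf -> forall i, - a i <= u t 0 i <= a i) ->
  L2norm (L2class p - L2class v) ^+ 2 + L2norm (L2class u - L2class p) ^+ 2
    <= L2norm (L2class u - L2class v) ^+ 2.
Proof.
move=> a0 pE ub; rewrite -!L2class_sub; apply: L2norm_sqrD_le => t tD.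
rewrite !enorm_sqr -big_split/=; apply: ler_sum => i _.
rewrite !mxE pE mxE.
by apply: clamp_pythagoras => //; exact: ub.
Qed.

Theorem theorem2 (R : realType) (t0 tf : R) (t0_le_tf : t0 <= tf)
    (m : nat) (a : 'I_m -> R) (a_ge0 : forall i, 0 <= a i)
    (uminus : L2 t0 tf m) (v : L2fun t0 tf m) (v_uminus : L2class v = uminus) :
  exists p : L2fun t0 tf m,
    (forall w : L2 t0 tf m,
       is_projection (box a) uminus w <-> w = L2class p) /\
    (forall t, t0 <= t <= tf -> forall i : 'I_m,
       [/\ a i <= v t 0 i -> p t 0 i = a i,
           - a i <= v t 0 i <= a i -> p t 0 i = v t 0 i &
           v t 0 i <= - a i -> p t 0 i = - a i]).
Proof.
pose p : L2fun t0 tf m := MkL2fun (clamp_fun_sqint a v a_ge0).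
have pE t i : p t 0 i = clamp (a i) (v t 0 i) by rewrite /= mxE.
have pbox : box a (L2class p).
  by exists p => // t _ i; rewrite pE; exact: clamp_bounds.
exists p; split=> [w|t _ i]; last first.
  by rewrite pE; split; [exact: clamp_ge|exact: clamp_id|exact: clamp_le].
rewrite -v_uminus; split=> [[[u <- ub] umin]|->].
- have up := box_pythagoras a v p u a_ge0 erefl ub.
  have pu := umin _ pbox.
  apply/eqP; rewrite -subr_eq0; apply/eqP/L2norm_eq0/eqP.
  by rewrite eq_le sqr_ge0 andbT; lra.
- split=> // _ [u <- ub].
  have := box_pythagoras a v p u a_ge0 erefl ub.
  by have := sqr_ge0 (L2norm (L2class u - L2class p)); lra.
Qed.
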